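(* Let $P:\{\pm1\}^k\to\{0,1\}$ be a $k$-ary Boolean predicate, and let $\nu$ be a pairwise-uniform distribution over $\{\pm1\}^k$ such that there is a multiset $S\subseteq\{\pm1\}^k$ with $\nu(x)=\Pr_{s\sim S}(s=x)$ for each $x\in\{\pm1\}^k$. Suppose $\mathbb{E}_{x\sim\nu}[P(x)]=\beta>\mathbb{E}_{x\sim\{\pm1\}^k}[P(x)]$ (the latter under the uniform distribution). Then for any constant $\epsilon>0$ there exist an integer $r=O_{\epsilon,k}(|S|^3)$, a rational $\tilde\epsilon\le\epsilon$, and a pairwise-uniform distribution $\theta$ over $\{\pm1\}^{r\times k}$ such that for every $y$ in the support of $\theta$, exactly $(\beta-\tilde\epsilon)r$ of the $r$ rows of $y$ satisfy $P$.
   Context: A distribution on $\{\pm1\}^N$ is pairwise uniform if each coordinate is uniform and each pair of distinct coordinates is uniformly distributed on $\{\pm1\}^2$; for $\theta$ this refers to all $rk$ entries of the matrix. *)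

(* Defs.v *)
From HB Require Import structures.
From mathcomp Require Import all_boot all_order all_algebra.
From mathcomp Require Import finmap multiset.
From mathcomp Require Import reals.

Set Implicit Arguments.
Unset Strict Implicit.
Unset Printing Implicit Defensive.

Import Order.TTheory GRing.Theory Num.Theory.
Local Open Scope ring_scope.

(* {±1}^I, where the boolean b stands for the sign (-1) ^+ b. *)
Notation cube I := {ffun I -> bool}.

Section FiniteDistributions.
Variables (R : realType) (T : finType).
Implicit Types mu : T -> R.

Definition is_distr mu : Prop := (forall x, 0 <= mu x) /\ \sum_x mu x = 1.

Definition Pr mu (A : pred T) : R := \sum_(x | A x) mu x.

Definition expect mu (f : T -> R) : R := \sum_x mu x * f x.

Definition uniform : T -> R := fun=> #|T|%:R^-1.

Definition in_support mu (x : T) : Prop := mu x != 0.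

End FiniteDistributions.

Arguments uniform R {T}.

Definition pairwise_uniform (R : realType) (I : finType) (mu : cube I -> R)
    : Prop :=
  [/\ is_distr mu,
      forall (i : I) (a : bool), Pr mu (fun x => x i == a) = 1 / 2
    & forall (i j : I) (a b : bool), i != j ->
        Pr mu (fun x => (x i == a) && (x j == b)) = 1 / 4].

(* nu is the law of a uniformly drawn element of S, with multiplicity; for
   empty S the right-hand side is 0, so nu is then not a distribution. *)
Definition sampled_from (R : realType) (T : finType) (S : {mset T}%mset)
    (nu : T -> R) : Prop :=
  forall x, nu x = (S x)%:R / (size S)%:R.

Definition indicator (R : realType) (T : Type) (P : T -> bool) : T -> R :=
  fun x => (P x)%:R.

Definition cube_row (r k : nat) (y : cube ('I_r * 'I_k)%type) (i : 'I_r)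
    : cube 'I_k :=
  [ffun j => y (i, j)].

Definition num_sat_rows (r k : nat) (P : cube 'I_k -> bool)
    (y : cube ('I_r * 'I_k)%type) : nat :=
  #|[set i : 'I_r | P (cube_row y i)]|.

(* Main.v *)
Require Import Defs.
From HB Require Import structures.
From mathcomp Require Import all_boot all_order all_algebra all_fingroup.
From mathcomp Require Import finmap multiset.
From mathcomp Require Import reals.
From mathcomp Require Import ring lra zify.

(** Write out many copies of S as the rows of a matrix and permute them uniformly
at random: the number of rows satisfying P is fixed, and the only failure of
pairwise uniformity is the negative correlation of distinct entries in one
column that comes from sampling without replacement.  It vanishes as soon as
the vector of column sums has covariance r times the identity.  To achieve
this, with a small probability p we add T copies of one uniformly random row b,
where p T^2 = r.  The number of satisfying rows is kept constant by replacing
some copies of S by copies of the whole cube, which satisfy P strictly less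
often; this is where the strict inequality is used. *)

Set Implicit Arguments.
Unset Strict Implicit.
Unset Printing Implicit Defensive.

Import Order.TTheory GRing.Theory Num.Theory.
Local Open Scope ring_scope.

(** * Averages over the symmetric group *)

Section PermutationAverages.
Variables (R : numDomainType) (T : finType).

(** Multiplying by a transposition shows that the sum does not depend on [i]; summed over all [i],
    every permutation contributes the total of [F], which is zero. *)
Lemma sum_perm1_eq0 (F : T -> R) (i : T) :
  \sum_a F a = 0 -> \sum_(s : {perm T}) F (s i) = 0.
Proof.
move=> F0.
have sameE a : \sum_(s : {perm T}) F (s a) = \sum_(s : {perm T}) F (s i).
  rewrite (reindex_inj (mulgI (tperm i a))) /=.
  by apply: eq_bigr => s _; rewrite permM tpermR.
have T_gt0 : (0 < #|T|)%N by apply/card_gt0P; exists i.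
apply/(mulIf (x := #|T|%:R)); first by rewrite pnatr_eq0 -lt0n.
rewrite mul0r mulr_natr -sumr_const -(eq_bigr _ (fun a _ => sameE a)).
rewrite exchange_big /= big1 // => s _.
by rewrite -[RHS]F0 [RHS](reindex_inj (@perm_inj _ s)).
Qed.

(** The same averaging over ordered pairs of distinct points, on which the symmetric group acts
    transitively. *)
Lemma sum_perm2_eq0 (F : T -> T -> R) (i j : T) : i != j ->
    \sum_(p : T * T | p.1 != p.2) F p.1 p.2 = 0 ->
  \sum_(s : {perm T}) F (s i) (s j) = 0.
Proof.
move=> ij F0.
have sameE (p : T * T) : p.1 != p.2 ->
    \sum_(s : {perm T}) F (s p.1) (s p.2) = \sum_(s : {perm T}) F (s i) (s j).
  (* The first transposition takes [i] to [a]; the second takes the image of [j] to [b] and fixes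
     [a]. *)
  case: p => a b /= ab; pose t := (tperm i a * tperm (tperm i a j) b)%g.
  have ti : t i = a.
    rewrite permM tpermL tpermD //; last by rewrite eq_sym.
    by rewrite -[X in _ != X](tpermL i) (inj_eq perm_inj) eq_sym.
  have tj : t j = b by rewrite permM tpermL.
  clearbody t; rewrite [RHS](reindex_inj (mulgI t)) /=.
  by apply: eq_bigr => s _; rewrite !permM ti tj.
apply/(mulIf (x := #|[pred p : T * T | p.1 != p.2]|%:R)).
  by rewrite pnatr_eq0 -lt0n; apply/card_gt0P; exists (i, j).
rewrite mul0r mulr_natr -sumr_const -(eq_bigr _ sameE).
rewrite exchange_big /= big1 // => s _.
have s_inj : injective (fun p : T * T => (s p.1, s p.2)).
  by move=> [a b] [a' b'] /= [/perm_inj-> /perm_inj->].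
rewrite -[RHS]F0 [RHS](reindex_inj s_inj) /=.
by apply: eq_bigl => p; rewrite (inj_eq perm_inj).
Qed.

End PermutationAverages.

(** * Pairwise uniformity through characters of degree one and two *)

Definition chi (R : pzRingType) (I : finType) (i : I) (x : cube I) : R :=
  (-1) ^+ x i.

Section Characters.
Variables (R : realType) (I : finType).
Implicit Types (mu : cube I -> R) (i j : I).

Lemma chi_sqr i (x : cube I) : chi R i x * chi R i x = 1.
Proof. by rewrite /chi -expr2 sqrr_sign. Qed.

(** The event [x i = a] has indicator [(1 + (-1)^a chi_i) / 2], so the events on one or two
    coordinates expand into characters of degree at most two. *)
Lemma pairwise_uniform_of_chi mu : is_distr mu ->
    (forall i, expect mu (chi R i) = 0) ->
    (forall i j, i != j -> expect mu (fun x => chi R i x * chi R j x) = 0) ->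
  pairwise_uniform mu.
Proof.
move=> mu_distr chi1 chi2; split=> // [i a|i j a b ij].
- transitivity (\sum_x (mu x + (-1) ^+ a * (mu x * chi R i x)) / 2).
    rewrite /Pr big_mkcond; apply: eq_bigr => x _; rewrite /chi.
    by case: (x i) a => -[] /=; field.
  rewrite -mulr_suml big_split -mulr_sumr /= mu_distr.2.
  by rewrite -/(expect _ (chi R i)) chi1 mulr0 addr0.
- transitivity (\sum_x (mu x + (-1) ^+ a * (mu x * chi R i x)
      + (-1) ^+ b * (mu x * chi R j x)
      + (-1) ^+ a * (-1) ^+ b * (mu x * (chi R i x * chi R j x))) / 4).
    rewrite /Pr big_mkcond; apply: eq_bigr => x _; rewrite /chi.
    by case: (x i) (x j) a b => -[] [] [] /=; field.
  rewrite -mulr_suml !big_split -!mulr_sumr /= mu_distr.2.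
  rewrite -/(expect _ (chi R i)) -/(expect _ (chi R j)) !chi1.
  by rewrite -/(expect _ (fun x => chi R i x * chi R j x)) chi2 // !mulr0 !addr0.
Qed.

Lemma pairwise_uniform_chi mu i :
  pairwise_uniform mu -> expect mu (chi R i) = 0.
Proof.
move=> [_ mu1 _].
transitivity (Pr mu (fun x => x i == false) - Pr mu (fun x => x i == true)).
  rewrite /Pr big_mkcond [X in _ - X]big_mkcond -sumrB /expect.
  by apply: eq_bigr => x _; rewrite /chi; case: (x i) => /=; ring.
by rewrite !mu1 subrr.
Qed.

Lemma pairwise_uniform_chi2 mu i j : pairwise_uniform mu -> i != j ->
  expect mu (fun x => chi R i x * chi R j x) = 0.
Proof.
move=> [_ _ mu2] ij; pose p a b := Pr mu (fun x => (x i == a) && (x j == b)).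
transitivity (p false false - p false true - (p true false - p true true)).
  have PrE A : Pr mu A = \sum_x if A x then mu x else 0 by exact: big_mkcond.
  rewrite /p !PrE -!sumrB /expect.
  by apply: eq_bigr => x _; rewrite /chi; case: (x i) (x j) => -[] /=; ring.
by rewrite /p !mu2 // !subrr.
Qed.

(** Flipping coordinate [i] preserves [g] and negates the character, so the sum equals its own
    negative. *)
Lemma sum_chi_invariant i (g : cube I -> R) :
    (forall x y : cube I, (forall j, j != i -> x j = y j) -> g x = g y) ->
  \sum_x chi R i x * g x = 0.
Proof.
move=> g_inv; pose flip (x : cube I) : cube I := [ffun j => (j == i) (+) x j].
have flipK : involutive flip.
  by move=> x; apply/ffunP => j; rewrite !ffunE addKb.
suff : \sum_x chi R i x * g x = - \sum_x chi R i x * g x by lra.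
rewrite {1}(reindex_inj (inv_inj flipK)) /= -sumrN.
apply: eq_bigr => x _; rewrite (g_inv (flip x) x); last first.
  by move=> j /negPf ji; rewrite ffunE ji.
by rewrite /chi ffunE eqxx signrN mulNr.
Qed.

Lemma sum_chi i : \sum_x chi R i x = 0.
Proof.
under eq_bigr do rewrite -[chi R i _]mulr1.
exact: (sum_chi_invariant (g := fun=> 1)).
Qed.

Lemma sum_chi2 i j : i != j -> \sum_x chi R i x * chi R j x = 0.
Proof.
by move=> ij; apply: sum_chi_invariant => x y; rewrite /chi => ->; rewrite // eq_sym.
Qed.

End Characters.

(** * Mixtures of shuffled row multisets *)

Section Law.
Variables (R : realType) (Omega T : finType) (w : Omega -> R) (f : Omega -> T).

Definition law (y : T) : R := \sum_(o | f o == y) w o.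

Lemma expect_law (g : T -> R) : expect law g = \sum_o w o * g (f o).
Proof.
rewrite (partition_big f predT) //=; apply: eq_bigr => y _.
by rewrite mulr_suml; apply: eq_bigr => o /eqP->.
Qed.

Lemma law_distr : is_distr w -> is_distr law.
Proof.
move=> [w_ge0 w_sum]; split=> [y|]; first exact: sumr_ge0.
by rewrite -w_sum (partition_big f predT).
Qed.

Lemma law_support y : in_support law y -> exists o, f o = y.
Proof.
move=> /eqP yN0; case: (pickP (fun o => f o == y)) => [o /eqP <-|fN].
  by exists o.
by case: yN0; rewrite /law big_pred0.
Qed.

End Law.

(** Here [n] encodes a multiset of rows by multiplicities. Taking [F] to be 1, a character or the
    indicator of P gives the number of rows, a column sum or the number of satisfying rows. *)
Definition mass (R : pzSemiRingType) (T : finType) (n : T -> nat) (F : T -> R) : R :=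
  \sum_x (n x)%:R * F x.

Lemma arrange (R : pzSemiRingType) (T : finType) (n : T -> nat) (r : nat) :
    (\sum_x n x = r)%N ->
  exists v : {ffun 'I_r -> T},
    forall F : T -> R, \sum_i F (v i) = mass n F.
Proof.
move=> n_sum; pose s := flatten [seq nseq (n x) x | x <- index_enum T].
have s_size : size s == r.
  rewrite /s size_flatten /shape -map_comp sumnE big_map -n_sum.
  by apply/eqP/eq_bigr => x _; rewrite /= size_nseq.
exists [ffun i => tnth (Tuple s_size) i] => F.
under eq_bigr do rewrite ffunE.
rewrite -(big_tuple _ _ (Tuple s_size) xpredT F) /= big_flatten big_map.
by apply: eq_bigr => x _; rewrite big_nseq iter_addr_0 mulr_natl.
Qed.

(** [theta] draws [o] from [w], lists the rows of [n o] and shuffles them uniformly. For entries in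
    distinct rows the correlation is proportional to the expected product of two column sums minus
    its diagonal part; the covariance hypothesis makes this difference zero. *)
Lemma exchangeable_mixture (R : realType) (k r : nat) (Omega : finType)
    (w : Omega -> R) (n : Omega -> cube 'I_k -> nat) :
    is_distr w -> (forall o, (\sum_x n o x = r)%N) ->
    (forall j, expect w (fun o => mass (n o) (chi R j)) = 0) ->
    (forall j j', j != j' ->
      expect w (fun o => mass (n o) (fun x => chi R j x * chi R j' x)) = 0) ->
    (forall j j',
      expect w (fun o => mass (n o) (chi R j) * mass (n o) (chi R j'))
        = r%:R *+ (j == j')) ->
  exists theta : cube ('I_r * 'I_k)%type -> R,
    pairwise_uniform theta /\
    forall y, in_support theta y ->
      exists o, forall P, (num_sat_rows P y)%:R = mass (n o) (indicator R P).
Proof.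
move=> w_distr n_sum w1 w2 w_cov.
have /fin_all_exists[v vE] o : exists v : {ffun 'I_r -> cube 'I_k},
    forall F : cube 'I_k -> R, \sum_i F (v i) = mass (n o) F.
  exact: arrange.
pose N : R := #|{perm 'I_r}|%:R.
have N_neq0 : N != 0.
  by rewrite pnatr_eq0 -lt0n; apply/card_gt0P; exists 1%g.
pose W (os : Omega * {perm 'I_r}) : R := w os.1 / N.
pose Y (os : Omega * {perm 'I_r}) : cube ('I_r * 'I_k)%type :=
  [ffun ij => v os.1 (os.2 ij.1) ij.2].
have W_distr : is_distr W.
  split=> [os|]; first by rewrite divr_ge0 ?ler0n ?w_distr.1.
  rewrite -(pair_bigA _ (fun o s => W (o, s))) /= -[RHS]w_distr.2.
  by apply: eq_bigr => o _; rewrite /W /= sumr_const -mulr_natr divfK.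
have expectE g : expect (law W Y) g
    = N^-1 * \sum_(s : {perm 'I_r}) \sum_o w o * g (Y (o, s)).
  rewrite expect_law -(pair_bigA _ (fun o s => W (o, s) * g (Y (o, s)))) /=.
  rewrite exchange_big mulr_sumr; apply: eq_bigr => s _ /=.
  by rewrite mulr_sumr; apply: eq_bigr => o _; rewrite /W /=; ring.
have chiE o s i j : chi R (i, j) (Y (o, s)) = chi R j (v o (s i)).
  by rewrite /chi ffunE.
exists (law W Y); split; last first.
  move=> y /law_support[[o s] <-]; exists o => P; rewrite -vE.
  rewrite [RHS](reindex_inj (@perm_inj _ s)) /num_sat_rows -sum1dep_card natr_sum.
  rewrite big_mkcond; apply: eq_bigr => i _ /=; rewrite /indicator.
  have -> : cube_row (Y (o, s)) i = v o (s i) by apply/ffunP => j; rewrite !ffunE.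
  by case: (P _).
apply: pairwise_uniform_of_chi; first exact: law_distr.
  move=> [i j]; rewrite expectE.
  under eq_bigr do under eq_bigr do rewrite chiE.
  rewrite (sum_perm1_eq0 (F := fun a => \sum_o w o * chi R j (v o a))) ?mulr0 //.
  rewrite exchange_big /= -[RHS](w1 j); apply: eq_bigr => o _.
  by rewrite -mulr_sumr vE.
move=> [i j] [i' j'] ij; rewrite expectE.
under eq_bigr do under eq_bigr do rewrite !chiE.
pose F a b := \sum_o w o * (chi R j (v o a) * chi R j' (v o b)).
have F_diag : \sum_a F a a = r%:R *+ (j == j').
  rewrite exchange_big /=; case: eqP => [<-|/eqP jj']; last first.
    rewrite -[RHS](w2 _ _ jj'); apply: eq_bigr => o _.
    by rewrite -mulr_sumr (vE o (fun x => chi R j x * chi R j' x)).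
  under eq_bigr do under eq_bigr do rewrite chi_sqr mulr1.
  under eq_bigr do rewrite sumr_const card_ord -mulr_natr.
  by rewrite -mulr_suml w_distr.2 mul1r.
have [ii'|ii'] := eqVneq i i'.
  rewrite -ii' (sum_perm1_eq0 (F := fun a => F a a)) ?mulr0 // F_diag.
  by have [jj'|//] := eqVneq j j'; rewrite ii' jj' eqxx in ij.
rewrite (sum_perm2_eq0 (F := F)) ?mulr0 //.
(* Over all ordered pairs of rows the sum is the covariance of the column sums. It equals the
   diagonal part [F_diag], so nothing is left off the diagonal. *)
have : \sum_(p : 'I_r * 'I_r) F p.1 p.2 = r%:R *+ (j == j').
  rewrite exchange_big /= -[RHS]w_cov; apply: eq_bigr => o _.
  rewrite -mulr_sumr -!vE big_distrlr /= pair_bigA; congr (_ * _).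
rewrite (bigID (fun p => p.1 == p.2)) /= => tot; apply: (addrI (r%:R *+ (j == j'))).
rewrite addr0 -[in RHS]tot -{1}F_diag; congr (_ + _).
rewrite (reindex_onto (fun a : 'I_r => (a, a)) fst) /=; last first.
  by move=> [a b] /= /eqP->.
by apply: eq_bigl => a; rewrite !eqxx.
Qed.

(** * Parameters and row multisets for the theorem *)

Lemma expect_uniformE (R : realType) (T : finType) (F : T -> R) :
  expect (uniform R) F = (\sum_x F x) / #|T|%:R.
Proof. by rewrite /expect -mulr_sumr mulrC. Qed.

Theorem theorem7 (R : realType) (k : nat) (eps : R) (eps_gt0 : 0 < eps) :
  exists C : nat,
    forall (P : cube 'I_k -> bool) (nu : cube 'I_k -> R)
           (S : {mset (cube 'I_k)}%mset) (beta : R),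
      pairwise_uniform nu ->
      sampled_from S nu ->
      expect nu (indicator R P) = beta ->
      expect (uniform R) (indicator R P) < beta ->
      exists (r : nat) (eps' : rat) (theta : cube ('I_r * 'I_k)%type -> R),
        [/\ (0 < r <= C * size S ^ 3)%N,
            ratr eps' <= eps,
            pairwise_uniform theta
          & forall y, in_support theta y ->
              (num_sat_rows P y)%:R = (beta - ratr eps') * r%:R].
Proof.
(* The error will be at most [1 / c]; [2 <= c] serves to make [p] a probability. *)
have [c c_ge2 c_ge] : exists2 c, (2 <= c)%N & 1 <= c%:R * eps.
  exists (Num.bound eps^-1).+2 => //.
  have : eps^-1 < (Num.bound eps^-1)%:R by rewrite archi_boundP // invr_ge0 ltW.
  rewrite -(ltr_pM2r eps_gt0) mulVf ?gt_eqF // => /ltW/le_trans; apply.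
  by rewrite ler_pM2r // ler_nat; lia.
pose K := #|cube 'I_k|.
exists (4 * K ^ 2 * (c * c.+1))%N => P nu S beta nu_pu nu_S nuP u_lt.
set u := expect _ _ in u_lt.
pose m := size S.
have K_gt0 : (0 < K)%N by apply/card_gt0P; exists [ffun=> false].
have nu_distr : is_distr nu by case: nu_pu.
have m_gt0 : (0 < m)%N.
  rewrite lt0n; apply/eqP => m0; have := nu_distr.2.
  rewrite big1 => [/eqP|x _]; first by rewrite eq_sym oner_eq0.
  by rewrite nu_S -/m m0 invr0 mulr0.
have mass_S F : mass S F = m%:R * expect nu F.
  rewrite /mass /expect mulr_sumr; apply: eq_bigr => x _.
  by rewrite nu_S mulrA mulrCA divff ?mulr1 // pnatr_eq0 -lt0n.
have mass_1 (F : cube 'I_k -> R) : mass (fun=> 1%N) F = K%:R * expect (uniform R) F.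
  rewrite expect_uniformE mulrC divfK ?pnatr_eq0 -?lt0n //.
  by apply: eq_bigr => x _; rewrite mul1r.
have expect_nu1 : expect nu (fun=> 1) = 1.
  by rewrite -[RHS]nu_distr.2; apply: eq_bigr => x _; rewrite mulr1.
have expect_u1 : expect (uniform R) (fun _ : cube 'I_k => 1) = 1.
  by rewrite expect_uniformE sumr_const divff // pnatr_eq0 -lt0n.
have expect_u_chi j : expect (uniform R) (chi R (j : 'I_k)) = 0.
  by rewrite expect_uniformE sum_chi mul0r.
have expect_u_chi2 (i j : 'I_k) : i != j ->
    expect (uniform R) (fun x => chi R i x * chi R j x) = 0.
  by move=> ij; rewrite expect_uniformE sum_chi2 ?mul0r.
(* A common multiple of [K] and [m], so that a block consists of whole copies of the cube or of [S];
   the factor 2 ensures [2 <= N]. *)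
pose N := (2 * K * m)%N.
pose s := (2 * K * \sum_x S x * P x)%N; pose s' := (2 * m * \sum_(x : cube 'I_k) P x)%N.
have sE : s%:R = N%:R * beta :> R.
  rewrite /s /N natrM [in RHS]natrM -[in RHS]mulrA -nuP -mass_S natr_sum; congr (_ * _).
  by apply: eq_bigr => x _; rewrite natrM.
have s'E : s'%:R = N%:R * u :> R.
  rewrite /s' /N [in RHS]mulnAC natrM [in RHS]natrM -[in RHS]mulrA -mass_1 natr_sum.
  by congr (_ * _); apply: eq_bigr => x _; rewrite mul1r.
have beta_le1 : beta <= 1.
  rewrite -nuP -nu_distr.2; apply: ler_sum => x _.
  by rewrite ler_piMr ?nu_distr.1 // /indicator; case: (P x).
have N_ge2 : (2 <= N)%N by rewrite /N; nia.
have N_gt0 : 0 < N%:R :> R by rewrite ltr0n; lia.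
have s_le : (s <= N)%N by rewrite -(ler_nat R) sE ler_piMr // ltW.
have s'_lt : (s' < s)%N by rewrite -(ltr_nat R) sE s'E ltr_pM2l.
(* A block of N rows, 2K copies of S or 2m copies of the cube, has s, resp. s',
   satisfying rows; each replacement of one by the other loses d of them. *)
pose d := (s - s')%N.
have d_gt0 : (0 < d)%N by rewrite subn_gt0.
have d_le : (d <= N)%N by rewrite /d; lia.
have dE : d%:R = N%:R * (beta - u) :> R by rewrite natrB 1?ltnW // sE s'E mulrBr.
(* [A] is the number of blocks. Its first term gives [c * T <= r], hence a small error; its second
   leaves room for up to [N * c] replacements. *)
pose T := (N * d * c)%N; pose A := (c.-1 * d * c + N * c)%N.
pose r := (N * A + T)%N.
have rE : r = (N * c * (c * d + N))%N.
  by rewrite /r /A /T; case: (c) c_ge2 => // c' _ /=; ring.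
(* D o is the number of replaced blocks.  The T extra rows are copies of b, or
   d * c blocks of copies of S in the branch without b. *)
pose Omega := (bool * cube 'I_k)%type.
pose D (o : Omega) := (if o.1 then N * c * P o.2 else c * s)%N.
pose n (o : Omega) x := ((A - D o) * (2 * K * S x) + D o * (2 * m)
  + (if o.1 then T * (x == o.2) else d * c * (2 * K * S x)))%N.
(* This keeps the subtraction [A - D o] in [n] from being truncated. *)
have D_le o : (D o <= A)%N.
  apply: (leq_trans _ (leq_addl _ _)); rewrite /D; case: o.1.
    by rewrite -[leqRHS]muln1 leq_mul // leq_b1.
  by rewrite mulnC leq_mul.
have massE o F : mass (n o) F =
    (A%:R - (D o)%:R) * N%:R * expect nu F
    + (D o)%:R * N%:R * expect (uniform R) F
    + T%:R * (if o.1 then F o.2 else expect nu F).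
  rewrite -natrB //; set a := (A - D o)%N.
  transitivity ((a * (2 * K))%:R * mass S F + (D o * (2 * m))%:R * mass (fun=> 1%N) F
      + if o.1 then T%:R * F o.2 else (d * c * (2 * K))%:R * mass S F).
    transitivity (mass (fun x => a * (2 * K) * S x + D o * (2 * m) * 1
        + if o.1 then T * (x == o.2) else d * c * (2 * K) * S x)%N F).
      by apply: eq_bigr => x _; rewrite /n -/a muln1 !mulnA.
    rewrite /mass !mulr_sumr; case: o.1.
      transitivity (\sum_x (((a * (2 * K))%:R * ((S x)%:R * F x)
          + (D o * (2 * m))%:R * (1%:R * F x)) + T%:R * ((x == o.2)%:R * F x))).
        by apply: eq_bigr => x _; rewrite !natrD !natrM; ring.
      rewrite !big_split /=; congr (_ + _).
      rewrite -mulr_sumr (bigD1 o.2) //= eqxx mul1r big1 ?addr0 // => x /negPf->.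
      by rewrite mul0r.
    rewrite -!big_split /=; apply: eq_bigr => x _.
    by rewrite !natrD !natrM; ring.
  by rewrite mass_S mass_1 /T /N; case: o.1; rewrite ?natrM; ring.
have n_sum o : (\sum_x n o x)%N = r.
  apply/eqP; rewrite -(eqr_nat R) natr_sum.
  have -> : \sum_x (n o x)%:R = mass (n o) (fun=> 1) :> R.
    by apply: eq_bigr => x _; rewrite mulr1.
  rewrite massE expect_nu1 expect_u1 if_same /r natrD natrM; apply/eqP; ring.
pose p : R := r%:R / T%:R ^+ 2.
have c_gt0 : (0 < c)%N by apply: ltnW.
have T_gt0 : 0 < T%:R :> R by rewrite ltr0n /T /N !muln_gt0 K_gt0 m_gt0 d_gt0 c_gt0.
have r_gt0 : (0 < r)%N by rewrite /r addn_gt0 -(ltr0n R T) T_gt0 orbT.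
have p_ge0 : 0 <= p by rewrite divr_ge0 ?exprn_ge0 ?ler0n.
(* Dividing [r <= T ^ 2] by [N * c] leaves [c * d + N <= N * c * d * d]. Each summand is at most
   half of the right side, since [N] and [c] are at least 2. *)
have p_le1 : p <= 1.
  rewrite ler_pdivrMr ?exprn_gt0 // mul1r -natrX ler_nat rE.
  have -> : (T ^ 2 = N * c * (N * c * d * d))%N by rewrite /T; ring.
  have cd_le : (2 * (c * d) <= N * c * d * d)%N.
    by apply: (leq_trans (leq_mul N_ge2 (leqnn (c * d)%N))); rewrite mulnA leq_pmulr.
  have N_le : (2 * N <= N * c * d * d)%N.
    rewrite mulnC; apply: (leq_trans (leq_mul (leqnn N) c_ge2)).
    by rewrite -mulnA leq_pmulr // muln_gt0 d_gt0.
  by rewrite leq_mul2l; apply/orP; right; lia.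

(* The random branch and the moments of the column sums *)
pose w (o : Omega) : R := (if o.1 then p else 1 - p) / K%:R.
have w_distr : is_distr w.
  split=> [o|]; first by rewrite divr_ge0 ?ler0n //; case: o.1; rewrite ?subr_ge0.
  rewrite -(pair_bigA _ (fun e b => w (e, b))) big_bool /w /= !sumr_const.
  by rewrite -mulrnDl -mulrDl addrCA subrr addr0 mul1r -[LHS]mulr_natr mulVf //
    pnatr_eq0 -lt0n.
have expect_w (G : cube 'I_k -> R) :
    expect w (fun o => if o.1 then G o.2 else 0) = p * expect (uniform R) G.
  rewrite /expect -(pair_bigA _ (fun e b => w (e, b) * if e then G b else 0)).
  rewrite big_bool /= [X in _ + X]big1 ?addr0 => [|b _]; last by rewrite mulr0.
  by rewrite mulr_sumr; apply: eq_bigr => b _; rewrite /w /uniform mulrA.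
(* Whole blocks contribute nothing to such [F], however many are replaced; only the copies of [b]
   remain. *)
have mass_balanced o F : expect nu F = 0 -> expect (uniform R) F = 0 ->
    mass (n o) F = if o.1 then T%:R * F o.2 else 0.
  by rewrite massE => -> ->; case: o.1; rewrite !mulr0 !add0r.
have expect_mass F : expect nu F = 0 -> expect (uniform R) F = 0 ->
    expect w (fun o => mass (n o) F) = 0.
  move=> nuF uF; under [LHS]eq_bigr do rewrite mass_balanced //.
  rewrite -/(expect _ _) (expect_w (fun b => T%:R * F b)) /expect.
  under eq_bigr do rewrite mulrCA.
  by rewrite -mulr_sumr -/(expect _ _) uF !mulr0.
have [] := exchangeable_mixture w_distr n_sum.
- by move=> j; rewrite expect_mass ?expect_u_chi ?(pairwise_uniform_chi _ nu_pu).
- by move=> i j ij; rewrite expect_mass ?expect_u_chi2 ?(pairwise_uniform_chi2 nu_pu).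
(* The covariance is [p * T ^ 2] times that of one uniform row, and [p * T ^ 2 = r]. *)
- move=> i j.
  transitivity (expect w (fun o => if o.1 then
      T%:R ^+ 2 * (chi R i o.2 * chi R j o.2) else 0)).
    apply: eq_bigr => o _.
    rewrite !mass_balanced ?expect_u_chi ?(pairwise_uniform_chi _ nu_pu) //.
    by case: o.1; [congr (_ * _); ring | rewrite mul0r].
  rewrite (expect_w (fun b => T%:R ^+ 2 * (chi R i b * chi R j b))) /expect.
  under eq_bigr do rewrite mulrCA.
  rewrite -mulr_sumr mulrA /p divfK; last by rewrite expf_neq0 ?gt_eqF.
  rewrite -/(expect _ (fun x => chi R i x * chi R j x)).
  have [->|ij] := eqVneq i j; last by rewrite expect_u_chi2 // mulr0.
  rewrite -[RHS]mulr1; congr (_ * _); rewrite -[RHS]expect_u1.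
  by apply: eq_bigr => x _; rewrite chi_sqr.

(* Size, rational error and the number of satisfying rows *)
move=> theta [theta_pu theta_supp].
(* As [beta = s / N], this is the rational form of [beta * T / r]; it makes the target count
   [beta * (r - T) = A * s]. *)
pose eps' : rat := s%:R / N%:R * (T%:R / r%:R).
have eps'E : ratr eps' = beta * (T%:R / r%:R) :> R.
  rewrite /eps' rmorphM !fmorph_div !rmorph_nat sE; congr (_ * _).
  by rewrite mulrC mulKf ?gt_eqF.
exists r, eps', theta; split=> //.
(* From [d <= N] comes a bound quadratic in [m], and [m ^ 2 <= m ^ 3] as [m] is positive. *)
- rewrite r_gt0 /= rE (@leq_trans (N * c * (c * N + N))) //.
    by rewrite leq_mul2l leq_add2r leq_mul2l d_le !orbT.
  have -> : (N * c * (c * N + N) = 4 * K ^ 2 * (c * c.+1) * m ^ 2)%N.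
    by rewrite /N; ring.
  by rewrite leq_mul2l leq_pexp2l ?orbT.
- rewrite eps'E (@le_trans _ _ (T%:R / r%:R)) //.
    by rewrite ler_piMl ?divr_ge0 ?ler0n.
  rewrite ler_pdivrMr ?ltr0n // (@le_trans _ _ (eps * (c * T)%:R)) //.
    by rewrite natrM mulrA (mulrC eps) ler_peMl ?ler0n.
  by rewrite ler_pM2l // ler_nat rE /T; nia.
move=> y /theta_supp[o ->]; rewrite massE nuP -/u eps'E.
have -> : (beta - beta * (T%:R / r%:R)) * r%:R = N%:R * A%:R * beta.
  have -> : N%:R * A%:R = r%:R - T%:R :> R by rewrite /r natrD addrK natrM.
  by field; rewrite pnatr_eq0 -lt0n.
(* The extra rows satisfy P exactly as often as the [D o] replacements, losing [d] each, take away: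
   [T = N * c * d] and [T * beta = c * s * d]. *)
have -> : T%:R * (if o.1 then indicator R P o.2 else beta) = (D o)%:R * d%:R.
  by rewrite /D /T /indicator; case: o.1; rewrite ?[(c * s)%:R]natrM ?sE !natrM; ring.
by rewrite dE; ring.
Qed.
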